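(* Let $\mathcal{E}$ be a nilpotent evolution algebra over a quadratically closed field of characteristic different from $2$ such that its annihilator $\mathrm{ann}(\mathcal{E})$ is one-dimensional. Then $\mathcal{E}$ is modular if and only if $\mathcal{E}$ is distributive.
   Context: An evolution algebra over a field $\mathbb{K}$ is a finite-dimensional $\mathbb{K}$-algebra $\mathcal{E}$ (bilinear product, not necessarily associative) admitting a basis $B=\{e_1,\dots,e_n\}$, called a natural basis, with $e_ie_j=0$ for $i\neq j$. Put $\mathcal{E}^1=\mathcal{E}$ and $\mathcal{E}^{k+1}=\sum_{i=1}^k\mathcal{E}^i\mathcal{E}^{k+1-i}$; $\mathcal{E}$ is nilpotent if $\mathcal{E}^k=0$ for some $k$. The annihilator is $\mathrm{ann}(\mathcal{E})=\{x\in\mathcal{E}: x\mathcal{E}=0\}$, which equals the span of those $e_i\in B$ with $e_i^2=0$. A field is quadratically closed if every element is a square. $\langle S\rangle$ denotes the subalgebra generated by $S$. $\mathcal{E}$ is distributive if $\langle U,V\cap W\rangle=\langle U,V\rangle\cap\langle U,W\rangle$ for all subalgebras $U,V,W$ of $\mathcal{E}$, and modular if $\langle U,V\cap W\rangle=\langle U,V\rangle\cap W$ for all subalgebras $U,V,W$ of $\mathcal{E}$ with $U\subseteq W$. *)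

(* Defs.v *)
From HB Require Import structures.
From mathcomp Require Import all_boot all_order all_algebra.

Set Implicit Arguments.
Unset Strict Implicit.
Unset Printing Implicit Defensive.

Import GRing.Theory.
Local Open Scope ring_scope.

(* MathComp has no non-associative algebras: an algebra is a vector space   *)
(* [E] together with its bilinear product [mul].                            *)

Definition quadratically_closed (K : fieldType) : Prop :=
  forall a : K, exists b : K, b ^+ 2 = a.

Section Algebra.

Variables (K : fieldType) (E : vectType K) (mul : {bilinear E -> E -> E}).
Implicit Types (U V W : {vspace E}) (S : {pred E}) (x y : E).

Definition natural_basis (B : seq E) : Prop :=
  basis_of fullv B /\
  forall i j, (i < size B)%N -> (j < size B)%N -> i <> j -> mul B`_i B`_j = 0.

Definition evolution_algebra : Prop := exists B : seq E, natural_basis B.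

Definition prodvs U V : {vspace E} :=
  <<[seq mul u v | u <- vbasis U, v <- vbasis V]>>%VS.

Lemma prodvsP U V W :
  reflect (forall u v, u \in U -> v \in V -> mul u v \in W)
          (prodvs U V <= W)%VS.
Proof.
apply: (iffP idP) => [sUVW u v Uu Vv | UVW].
  apply: (subvP sUVW).
  rewrite (coord_vbasis Uu) (coord_vbasis Vv) linear_sumlz rpred_sum // => i _.
  rewrite linear_sumr rpred_sum // => j _.
  rewrite linearZl_LR linearZr_LR !memvZ // memv_span //.
  by apply/allpairsP; exists ((vbasis U)`_i, (vbasis V)`_j);
    rewrite !mem_nth ?size_tuple.
apply/span_subvP=> _ /allpairsP[[u v] /= [Uu Vv ->]].
by apply: UVW; apply: vbasis_mem.
Qed.

(* [powers n] lists E^1, ..., E^(n+1). *)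
Fixpoint powers (n : nat) : seq {vspace E} :=
  if n is m.+1 then
    let s := powers m in
    rcons s (\sum_(i < m.+1) prodvs (nth 0%VS s i) (nth 0%VS s (m - i)))%VS
  else [:: fullv].

(* The junk value [power 0] is E. *)
Definition power (k : nat) : {vspace E} := nth 0%VS (powers k.-1) k.-1.

Lemma size_powers n : size (powers n) = n.+1.
Proof. by elim: n => //= n IHn; rewrite size_rcons IHn. Qed.

Lemma nth_powers n i : (i <= n)%N -> nth 0%VS (powers n) i = power i.+1.
Proof.
elim: n => [|n IHn]; first by rewrite leqn0 => /eqP->.
rewrite leq_eqVlt => /predU1P[-> //|]; rewrite ltnS => le_in.
by rewrite [powers _]/= nth_rcons size_powers ltnS le_in IHn.
Qed.

Lemma power1 : power 1 = fullv.
Proof. by []. Qed.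

Lemma powerS k : (0 < k)%N ->
  power k.+1 = (\sum_(1 <= i < k.+1) prodvs (power i) (power (k.+1 - i)))%VS.
Proof.
case: k => // k _; rewrite {1}/power [powers _]/=.
rewrite nth_rcons size_powers ltnn eqxx big_add1 big_mkord.
apply: eq_bigr => i _; rewrite !nth_powers ?leq_subr //; last by rewrite -ltnS.
by rewrite subSS subSn // -ltnS.
Qed.

Definition nilpotent_algebra : Prop :=
  exists2 k, (0 < k)%N & power k = 0%VS.

Definition annihilator : {vspace E} :=
  (\bigcap_(i < \dim {:E}) lker (linfun (applyr mul (vbasis {:E})`_i)))%VS.

Lemma mem_annihilator x : x \in annihilator <-> forall y, mul x y = 0.
Proof.
split=> [ann_x y | x0]; last first.
  rewrite memvE; apply/subv_bigcapP => i _; rewrite -memvE memv_ker.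
  by rewrite lfunE /= x0.
rewrite (coord_vbasis (memvf y)) linear_sumr big1 // => i _.
have := ann_x; rewrite memvE => /subv_bigcapP/(_ i isT).
rewrite -memvE memv_ker lfunE /= => /eqP x_i.
by rewrite linearZr_LR /= x_i scaler0.
Qed.

Definition subalgebra U : Prop :=
  forall x y, x \in U -> y \in U -> mul x y \in U.

(* <S>, the intersection of all subalgebras containing S *)
Definition generated S x : Prop :=
  forall U, subalgebra U -> {subset S <= U} -> x \in U.

Definition distributive_algebra : Prop :=
  forall U V W, subalgebra U -> subalgebra V -> subalgebra W ->
  forall x, generated [predU U & (V :&: W)%VS] x <->
            generated [predU U & V] x /\ generated [predU U & W] x.

Definition modular_algebra : Prop :=
  forall U V W, subalgebra U -> subalgebra V -> subalgebra W -> (U <= W)%VS ->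
  forall x, generated [predU U & (V :&: W)%VS] x <->
            generated [predU U & V] x /\ x \in W.

End Algebra.

(* Main.v *)
Require Import Defs.
From mathcomp Require Import all_boot all_order all_algebra.

(** Nilpotency lets us order a natural basis so that [e_i^2] lies in
    [F_(i+1)], where [F_j] is the span of [e_j, e_(j+1), ...].  If every
    [e_i^2] has a nonzero [e_(i+1)]-coefficient, then the [F_j] are the only
    subalgebras, so the subalgebras form a chain and [E] is distributive.
    Otherwise take the last [k] for which this fails. As the annihilator is a
    line, [e_k^2 <> 0] has leading term [d e_m] with [m > k + 1], while
    [e_(m-1)^2] has leading term [c e_m]. With [t^2 = - d / c], the elements
    [x, y = e_k +- t e_(m-1)] square into [F_(m+1)] whereas [x y] does not, and
    modularity fails for [<x> + F_(m+1)], [<y> + F_(m+1)] and [<x> + F_m]. *)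

Set Implicit Arguments.
Unset Strict Implicit.
Unset Printing Implicit Defensive.

Import GRing.Theory.
Local Open Scope ring_scope.

(** * Distributivity, modularity and comparable subalgebras *)

Section Generated.

Variables (K : fieldType) (E : vectType K) (mul : {bilinear E -> E -> E}).
Implicit Types (U V W : {vspace E}).

Lemma sub_generated (S T : {pred E}) x :
  {subset S <= T} -> generated mul S x -> generated mul T x.
Proof. by move=> sST genSx U algU sTU; apply: genSx => // y /sST/sTU. Qed.

(** The intersection collapses to [V], and then the second condition on the right follows from the
    first by monotonicity. *)
Lemma generated_comparable U V W : (V <= W)%VS ->
  forall x, generated mul [predU U & (V :&: W)%VS] x <->
            generated mul [predU U & V] x /\ generated mul [predU U & W] x.
Proof.
move=> sVW x; rewrite (capv_idPl sVW).
split=> [gUVx|[]//]; split=> //.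
apply: sub_generated gUVx => y /orP[Uy|Vy]; apply/orP; first by left.
by right; apply: (subvP sVW).
Qed.

(** Since the subalgebra [W] contains [U], together they generate just [W], which turns the
    distributive law into the modular one. *)
Lemma distributive_modular : distributive_algebra mul -> modular_algebra mul.
Proof.
move=> distE U V W algU algV algW sUW x.
split=> [/distE[] // gUV gUW|[gUV Wx]].
  split=> //; apply: gUW => // y /orP[]; last by [].
  exact: subvP.
by apply/distE => //; split=> // T _; apply; rewrite inE /= Wx orbT.
Qed.

Lemma distributive_of_chain :
  (forall V W, subalgebra mul V -> subalgebra mul W ->
     (V <= W)%VS || (W <= V)%VS) ->
  distributive_algebra mul.
Proof.
move=> chain U V W _ algV algW x.
have [/generated_comparable//|sWV] := orP (chain V W algV algW).
by rewrite capvC; have := generated_comparable U sWV x; tauto.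
Qed.

End Generated.

(** * Sorting a natural basis into triangular form *)

Section NaturalBasis.

Variables (K : fieldType) (E : vectType K) (mul : {bilinear E -> E -> E}).
Implicit Types (B : seq E).

Lemma mul_span0 (s : seq E) x v :
  (forall b, b \in s -> mul x b = 0) -> v \in <<s>>%VS -> mul x v = 0.
Proof.
move=> xs0; suff /subvP/[apply] : (<<s>> <= lker (linfun (mul x)))%VS.
  by rewrite memv_ker lfunE /= => /eqP.
by apply/span_subvP => b /xs0; rewrite memv_ker lfunE /= => ->.
Qed.

Lemma span_mul0 (s : seq E) x v :
  (forall b, b \in s -> mul b x = 0) -> v \in <<s>>%VS -> mul v x = 0.
Proof.
move=> xs0; suff /subvP/[apply] : (<<s>> <= lker (linfun (applyr mul x)))%VS.
  by rewrite memv_ker lfunE /= => /eqP.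
by apply/span_subvP => b /xs0; rewrite memv_ker lfunE /= => ->.
Qed.

Lemma natural_basis_ortho B : natural_basis mul B ->
  forall i j, i != j -> mul B`_i B`_j = 0.
Proof.
move=> [_ ortho] i j /eqP ne_ij.
have [le_Bi|lt_iB] := leqP (size B) i; first by rewrite nth_default // linear0l.
have [le_Bj|lt_jB] := leqP (size B) j; last exact: ortho.
by rewrite [B`_j]nth_default // linear0r.
Qed.

Lemma perm_natural_basis B1 B2 :
  perm_eq B1 B2 -> natural_basis mul B1 -> natural_basis mul B2.
Proof.
move=> eqB natB1; have [basB1 _] := natB1.
have basB2 : basis_of fullv B2 by rewrite -(perm_basis _ eqB).
split=> // i j lt_i lt_j ne_ij.
have uB2 : uniq B2 by apply: free_uniq (basis_free basB2).
have B1i : B2`_i \in B1 by rewrite (perm_mem eqB) mem_nth.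
have B1j : B2`_j \in B1 by rewrite (perm_mem eqB) mem_nth.
rewrite -(nth_index 0 B1i) -(nth_index 0 B1j); apply: natural_basis_ortho => //.
apply: contra_not_neq ne_ij => eq_ij; apply/eqP.
by rewrite -(nth_uniq 0 lt_i lt_j uB2) -(nth_index 0 B1i) eq_ij nth_index.
Qed.

(** The last summand of E^(k+1) is E^k E^1, and E^1 is the whole algebra. *)
Lemma mul_power k v y : (0 < k)%N ->
  v \in power mul k -> mul v y \in power mul k.+1.
Proof.
move=> k_gt0 v_k; rewrite powerS // big_nat_recr //= subSnn power1.
apply: (subvP (addvSr _ _)).
by apply: (prodvsP _ _ _ _ (subvv _)) => //; apply: memvf.
Qed.

(** Rank e_i by the deepest power of E containing e_i^2. If e_j occurs in e_i^2, then e_i^2 e_j is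
    e_j^2 up to a nonzero scalar and lies one power deeper, so e_j ranks strictly higher and sorting
    by rank puts it after e_i. *)
Lemma triangular_natural_basis :
    evolution_algebra mul -> nilpotent_algebra mul ->
  exists2 B, natural_basis mul B &
    forall i, mul B`_i B`_i \in <<drop i.+1 B>>%VS.
Proof.
move=> [B0 natB0] [N N_gt0 powN].
(* The cap at [N] ensures a maximum even when [mul x x = 0], which lies in every power. *)
pose p (x : E) := (\max_(k < N.+1 | mul x x \in power mul k) k)%N.
have p_max x k : (k <= N)%N -> mul x x \in power mul k -> (k <= p x)%N.
  move=> le_kN xk; exact: (leq_bigmax_cond (Ordinal (le_kN : (k < N.+1)%N))).
have p_mem x : [/\ mul x x \in power mul (p x), (0 < p x)%N & (p x <= N)%N].
  split; [|by apply: p_max => //; rewrite power1 memvf|]; last first.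
    by apply/bigmax_leqP => k _; rewrite -ltnS.
  (* The index 0 qualifies because the junk value [power 0] is all of E, so the maximum is
     attained. *)
  have : (0 < #|[pred k : 'I_N.+1 | mul x x \in power mul k]|)%N.
    by apply/card_gt0P; exists ord0; rewrite inE memvf.
  by case/(eq_bigmax_cond (@nat_of_ord _)) => k; rewrite inE /p => xk ->.
pose B := sort (relpre p leq) B0.
have natB : natural_basis mul B.
  by apply: perm_natural_basis natB0; rewrite perm_sym perm_sort.
have sortB i j : (i < size B)%N -> (p (B`_i)%R < p (B`_j)%R)%N -> (i < j)%N.
  move=> lt_i; apply: contraTT; rewrite -!leqNgt => le_ji.
  apply: (sorted_leq_nth (leT := relpre p leq)) => //.
  - by move=> x y z; apply: leq_trans.
  - by move=> x /=.
  - by apply: sort_sorted => x y; apply: leq_total.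
  - by rewrite inE (leq_ltn_trans le_ji).
exists B => // i.
have [le_Bi|lt_iB] := leqP (size B) i; first by rewrite nth_default // linear0l mem0v.
set x := mul _ _.
have [basB _] := natB.
have xE : x = \sum_(j < size B) coord (in_tuple B) j x *: B`_j.
  by apply: (coord_span (X := in_tuple B)); rewrite (span_basis basB) memvf.
rewrite xE; apply: rpred_sum => j _.
have [->|nz_j] := eqVneq (coord (in_tuple B) j x) 0; first by rewrite scale0r mem0v.
apply/memvZ/memv_span.
have lt_ij : (i < j)%N.
  apply: sortB => //; have [x_p p_gt0 p_le] := p_mem B`_i.
  have xj : mul x B`_j = coord (in_tuple B) j x *: mul B`_j B`_j.
    rewrite {1}xE linear_sumlz (bigD1 j) //= big1 ?addr0 ?linearZl_LR // => l ne_lj.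
    by rewrite linearZl_LR /= (natural_basis_ortho natB) ?scaler0.
  have Bj : mul B`_j B`_j \in power mul (p B`_i).+1.
    by rewrite -(scalerK nz_j (mul _ _)) -xj memvZ // mul_power.
  (* Rank [N] would give e_i^2 = 0 and kill the coefficient, so the next rank still respects the
     cap. *)
  apply: p_max => //; rewrite ltn_neqAle p_le andbT.
  apply: contraNneq nz_j => pN; move: x_p; rewrite pN powN memv0 => /eqP x0.
  by rewrite -/x in x0; rewrite x0 linear0.
have -> : B`_j = (drop i.+1 B)`_(j - i.+1) by rewrite nth_drop subnKC.
by rewrite mem_nth // size_drop ltn_sub2r // (leq_ltn_trans lt_ij).
Qed.

End NaturalBasis.

(** * The flag spanned by the tails of a triangular basis *)

Section Flag.

Variables (K : fieldType) (E : vectType K) (mul : {bilinear E -> E -> E}).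
Variable B : seq E.
Hypothesis natB : natural_basis mul B.
Hypothesis triB : forall i, mul B`_i B`_i \in <<drop i.+1 B>>%VS.

Local Notation F i := (<<drop i B>>%VS).

Let ortho i j : i != j -> mul B`_i B`_j = 0.
Proof. exact: natural_basis_ortho. Qed.

Lemma flag0 : F 0 = fullv.
Proof. by rewrite drop0; have [/span_basis] := natB. Qed.

Lemma flag_oversize i : (size B <= i)%N -> F i = 0%VS.
Proof. by move=> le_Bi; rewrite drop_oversize // span_nil. Qed.

Lemma flag_sub i j : (i <= j)%N -> (F j <= F i)%VS.
Proof.
by move=> le_ij; apply: sub_span => x; rewrite -(subnK le_ij) -drop_drop => /mem_drop.
Qed.

Lemma mem_flag i j : (i <= j)%N -> B`_j \in F i.
Proof.
move=> le_ij; have [le_Bj|lt_jB] := leqP (size B) j.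
  by rewrite nth_default ?mem0v.
by apply: (subvP (flag_sub le_ij)); rewrite (drop_nth 0 lt_jB) memv_span ?mem_head.
Qed.

Lemma flagP i v : v \in F i -> exists a, exists2 f, f \in F i.+1 & v = a *: B`_i + f.
Proof.
have [le_Bi|lt_iB] := leqP (size B) i.
  rewrite flag_oversize // memv0 => /eqP->; exists 0, 0; rewrite ?mem0v //.
  by rewrite scale0r addr0.
rewrite (drop_nth 0 lt_iB) span_cons => /memv_addP[_ /vlineP[a ->] [f Ff ->]].
by exists a, f.
Qed.

(** Freeness keeps e_i out of the span of the later basis vectors; coefficients are compared this
    way below. *)
Lemma scale_flag i a : (i < size B)%N -> a *: B`_i \in F i.+1 -> a = 0.
Proof.
move=> lt_iB; have [/basis_free freeB _] := natB.
have : free (drop i B) by move: freeB; rewrite -{1}(cat_take_drop i B) => /catr_free.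
rewrite (drop_nth 0 lt_iB) free_cons => /andP[notFi _] Fi; apply: contraNeq notFi => nz_a.
by rewrite -(scalerK nz_a B`_i) memvZ.
Qed.

Lemma mul_nth_flag i j v : (i < j)%N -> v \in F j -> mul B`_i v = 0 /\ mul v B`_i = 0.
Proof.
move=> lt_ij; have nth_drop_eq b : b \in drop j B -> exists2 l, i != l & b = B`_l.
  case/(nthP 0) => l _ <-; exists (j + l)%N; rewrite ?nth_drop //.
  by rewrite neq_ltn (leq_trans lt_ij) ?leq_addr.
split.
  by apply: (mul_span0 _ (s := drop j B)) => // _ /nth_drop_eq[l ne_il ->]; exact: ortho.
apply: (span_mul0 _ (s := drop j B)) => // _ /nth_drop_eq[l ne_il ->].
by rewrite ortho // eq_sym.
Qed.

Lemma mul_flagE i a b f g : f \in F i.+1 -> g \in F i.+1 ->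
  mul (a *: B`_i + f) (b *: B`_i + g) = (a * b) *: mul B`_i B`_i + mul f g.
Proof.
move=> Ff Fg; have [ig0 _] := mul_nth_flag (ltnSn i) Fg.
have [_ fi0] := mul_nth_flag (ltnSn i) Ff.
rewrite linearDl !linearD /= !linearZl_LR !linearZr_LR /= ig0 fi0 !scaler0 addr0 add0r.
by rewrite scalerA.
Qed.

(** Descending induction on [i]: the leading terms give a multiple of e_i^2, and the product of the
    tails lies even in [F i.+2]. *)
Lemma mul_flag i v w : v \in F i -> w \in F i -> mul v w \in F i.+1.
Proof.
have [d] := ubnP (size B - i); elim: d => // d IHd in i v w *; rewrite ltnS => le_d.
have [le_Bi|lt_iB] := leqP (size B) i.
  by rewrite flag_oversize // memv0 => /eqP-> _; rewrite linear0l mem0v.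
move=> /flagP[a [f Ff ->]] /flagP[b [g Fg ->]]; rewrite mul_flagE //.
rewrite rpredD ?memvZ //; apply: (subvP (flag_sub (leqnSn _))); apply: IHd => //.
by apply: leq_trans le_d; rewrite ltn_sub2l.
Qed.

(** * The uniserial case: the flag exhausts the subalgebras *)

Section Chain.

(** As e_i^2 already lies in [F i.+1], this says that its e_(i+1)-coefficient is nonzero. *)
Hypothesis stepB : forall i, (i.+1 < size B)%N -> mul B`_i B`_i \notin F i.+2.

(** Squaring a vector with leading index [i] gives one with leading index [i.+1], so by induction
    [U] contains [F i.+1]; removing the tail of [v] then leaves e_i in [U]. *)
Lemma flag_sub_subalgebra U i v :
  subalgebra mul U -> v \in U -> v \in F i -> v \notin F i.+1 -> (F i <= U)%VS.
Proof.
move=> algU; have [d] := ubnP (size B - i).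
elim: d => // d IHd in i v *; rewrite ltnS => le_d Uv Fv notFv.
have [le_Bi|lt_iB] := leqP (size B) i; first by rewrite flag_oversize // sub0v.
have [a [f Ff vE]] := flagP Fv.
have nz_a : a != 0.
  by apply: contraNneq notFv => a0; rewrite vE a0 scale0r add0r.
have sFU : (F i.+1 <= U)%VS.
  have [le_Bi1|lt_i1B] := leqP (size B) i.+1; first by rewrite flag_oversize // sub0v.
  apply: (IHd i.+1 (mul v v)); [|exact: algU|exact: mul_flag|].
    by apply: leq_trans le_d; rewrite ltn_sub2l.
  rewrite vE mul_flagE // rpredDr ?mul_flag //.
  apply: contra (stepB lt_i1B) => F2.
  by rewrite -(scalerK (mulf_neq0 nz_a nz_a) (mul B`_i _)) memvZ.
rewrite (drop_nth 0 lt_iB) span_cons subv_add sFU andbT -memvE.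
rewrite -(scalerK nz_a B`_i) memvZ // -(addrK f (a *: _)) -vE rpredB //.
exact: (subvP sFU).
Qed.

(** Descend the flag while it still contains [U]; at the first failure [U] has a vector with leading
    index [d], hence equals [F d]. *)
Lemma subalgebra_flag U : subalgebra mul U -> exists i, U = F i.
Proof.
move=> algU; suff H d : (U <= F d)%VS \/ exists i, U = F i.
  have [sUF|//] := H (size B); exists (size B).
  by apply/eqP; rewrite eqEsubv sUF flag_oversize ?sub0v.
elim: d => [|d [sUF|]]; [by left; rewrite flag0 subvf| |by right].
have [sUF1|/subvPn[v Uv notFv]] := boolP (U <= F d.+1)%VS; first by left.
right; exists d; apply: subv_anti; rewrite sUF.
exact: (flag_sub_subalgebra algU Uv (subvP sUF _ Uv)).
Qed.

Lemma distributive_flag : distributive_algebra mul.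
Proof.
apply: distributive_of_chain => V W /subalgebra_flag[i ->] /subalgebra_flag[j ->].
by have [/flag_sub->|/ltnW/flag_sub->] := leqP i j; rewrite ?orbT.
Qed.

End Chain.

(** * Modularity forces the uniserial case *)

Lemma subalgebra_line_flag x j :
  mul x x \in F j -> (forall v, v \in F j -> mul x v = 0 /\ mul v x = 0) ->
  subalgebra mul (<[x]> + F j).
Proof.
move=> Fxx x0 v w /memv_addP[_ /vlineP[a ->] [f Ff ->]].
(* The mixed terms vanish, so the product falls into the summand [F j]. *)
move=> /memv_addP[_ /vlineP[b ->] [g Fg ->]]; apply: (subvP (addvSr _ _)).
have [xg0 _] := x0 g Fg; have [_ fx0] := x0 f Ff.
rewrite linearDl !linearD /= !linearZl_LR !linearZr_LR /= xg0 fx0 !scaler0 addr0 add0r.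
by rewrite rpredD ?memvZ // (subvP (flag_sub (leqnSn j))) ?mul_flag.
Qed.

Lemma leading_term i v : v \in F i -> v != 0 ->
  exists2 m, (i <= m < size B)%N &
    exists2 d, d != 0 & exists2 f, f \in F m.+1 & v = d *: B`_m + f.
Proof.
have [n] := ubnP (size B - i); elim: n => // n IHn in i *; rewrite ltnS => le_n Fv nz_v.
have [le_Bi|lt_iB] := leqP (size B) i.
  by move: Fv nz_v; rewrite flag_oversize // memv0 => ->.
have [d [f Ff vE]] := flagP Fv.
have [d0|nz_d] := eqVneq d 0; last by exists i; [rewrite leqnn | exists d => //; exists f].
have [||m /andP[lt_im lt_mB] mP] := IHn i.+1 _ _ nz_v.
- by apply: leq_trans le_n; rewrite ltn_sub2l.
- by rewrite vE d0 scale0r add0r.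
by exists m => //; rewrite (ltnW lt_im).
Qed.

(** The last basis vector squares to zero; a second such vector would make the annihilator at least
    two-dimensional. *)
Lemma sqr_neq0 i : \dim (annihilator mul) = 1%N -> (i.+1 < size B)%N ->
  mul B`_i B`_i != 0.
Proof.
move=> ann1 lt_i1B; apply/eqP => Bi0.
have annP j : mul B`_j B`_j = 0 -> B`_j \in annihilator mul.
  move=> Bj0; apply/mem_annihilator => y; apply: (mul_span0 _ (s := B)); last first.
    by rewrite -[B]drop0 flag0 memvf.
  by move=> _ /(nthP 0)[l _ <-]; have [<-//|/ortho] := eqVneq j l.
have last0 : mul B`_(size B).-1 B`_(size B).-1 = 0.
  by have := triB (size B).-1; rewrite flag_oversize ?leqSpred // memv0 => /eqP.
pose X := [:: B`_i; B`_(size B).-1].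
have lt_il : (i < (size B).-1)%N by rewrite -ltnS prednK // (leq_trans _ lt_i1B).
have [/basis_free freeB _] := natB.
have freeX : free X.
  rewrite free_cons seq1_free span_seq1; apply/andP; split.
    apply/negP => /vlineP[a Ba]; have : 1 = 0 :> K.
      apply: (scale_flag (ltnW lt_i1B)); rewrite scale1r Ba memvZ //.
      exact: mem_flag.
    by move/eqP; rewrite oner_eq0.
  by apply: (free_not0 freeB); rewrite mem_nth // prednK // (leq_trans _ lt_i1B).
have sXann : (<<X>> <= annihilator mul)%VS.
  by apply/span_subvP => b; rewrite !inE => /orP[]/eqP->; apply: annP.
by have := dimvS sXann; rewrite ann1 (eqP freeX).
Qed.

(** The induction starts from the end of the basis, so the claim is known at all larger indices when
    a failure at [i] is refuted. *)
Lemma modular_step i :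
    quadratically_closed K -> 2%N \notin [pchar K] ->
    \dim (annihilator mul) = 1%N -> modular_algebra mul ->
  (i.+1 < size B)%N -> mul B`_i B`_i \notin F i.+2.
Proof.
move=> quadK charK annE modE.
have [n] := ubnP (size B - i); elim: n => // n IHn in i *; rewrite ltnS => le_n lt_i1B.
apply/negP => F2; have [//|m /andP[lt_im lt_mB]] := leading_term F2 _.
  exact: sqr_neq0.
(* From here the leading index of e_i^2 is [m.+1], so that e_m is the vector paired with e_i. *)
case: m => // m in lt_im lt_mB *; move=> [d nz_d [h Fh BiE]].
have [c [h' Fh' BmE]] := flagP (triB m).
have lt_im' : (i < m)%N by [].
have nz_c : c != 0.
  have : mul B`_m B`_m \notin F m.+2.
    apply: IHn => //; apply: leq_trans le_n; rewrite ltn_sub2l //.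
    exact: ltnW.
  by apply: contraNneq => c0; rewrite BmE c0 scale0r add0r.
(* The e_(m+1)-coefficient of [mul (z s) (z r)] will be d + s r c: it vanishes for s = r = t or -t,
   and is 2 d for the mixed product. *)
have [t t2E] := quadK (- (d / c)).
have nz_t : t != 0.
  apply: contra_eq_neq t2E => ->; rewrite expr0n /= eq_sym oppr_eq0.
  by rewrite mulf_neq0 ?invr_eq0.
have nz_2 : 2%:R != 0 :> K by move: charK; rewrite inE.
have lt_iB := ltnW lt_i1B.
pose z s := B`_i + s *: B`_m.
have mul_z s r : mul (z s) (z r) = mul B`_i B`_i + (s * r) *: mul B`_m B`_m.
  have ne_im : i != m by rewrite neq_ltn lt_im'.
  have ne_mi : m != i by rewrite eq_sym.
  rewrite /z linearDl !linearD /= !linearZl_LR !linearZr_LR /= (ortho ne_im) (ortho ne_mi).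
  by rewrite !scaler0 addr0 add0r scalerA.
have z_flag s v : v \in F m.+1 -> mul (z s) v = 0 /\ mul v (z s) = 0.
  move=> Fv; have [mv vm] := mul_nth_flag (ltnSn m) Fv.
  have [iv vi] := mul_nth_flag (ltnW lt_im : i < m.+1)%N Fv.
  by rewrite /z linearDl linearD /= linearZl_LR linearZr_LR /= mv vm iv vi scaler0 addr0.
have mul_zE s r : mul (z s) (z r) = (d + s * r * c) *: B`_m.+1 + (h + (s * r) *: h').
  by rewrite mul_z BiE BmE scalerDr scalerA scalerDl addrACA.
have sFi : (F m.+1 <= F i.+1)%VS by apply/flag_sub/ltnW.
have sF : (F m.+2 <= F m.+1)%VS by apply: flag_sub.
have sqr_z s : s ^+ 2 = t ^+ 2 -> mul (z s) (z s) \in F m.+2.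
  move=> s2; rewrite mul_zE -expr2 s2 t2E mulNr divfK // subrr scale0r add0r.
  by rewrite rpredD ?memvZ.
have alg2 s : s ^+ 2 = t ^+ 2 -> subalgebra mul (<[z s]> + F m.+2).
  move=> s2; apply: subalgebra_line_flag; first exact: sqr_z.
  by move=> v /(subvP sF); apply: z_flag.
have algW : subalgebra mul (<[z t]> + F m.+1).
  by apply: subalgebra_line_flag; [apply/(subvP sF)/sqr_z | apply: z_flag].
have z_out a s : a *: z s \in F m.+1 -> a = 0.
  move=> Faz; apply: (scale_flag lt_iB).
  have -> : a *: B`_i = a *: z s - (a * s) *: B`_m by rewrite /z scalerDr scalerA addrK.
  by apply: rpredB; [apply: (subvP sFi) | apply/memvZ/mem_flag].
pose U := (<[z t]> + F m.+2)%VS; pose V := (<[z (- t)]> + F m.+2)%VS.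
pose W := (<[z t]> + F m.+1)%VS.
have Nt2 : (- t) ^+ 2 = t ^+ 2 by rewrite sqrrN.
have sUW : (U <= W)%VS by rewrite addvS.
have [_ inW] := modE U V W (alg2 t erefl) (alg2 _ Nt2) algW sUW B`_m.+1.
(* Hence [U] and [V :&: W] generate nothing beyond [U]. *)
have sVWU : (V :&: W <= U)%VS.
  apply/subvP => v; rewrite memv_cap => /andP[].
  move=> /memv_addP[_ /vlineP[a ->] [g Fg ->]].
  move=> /memv_addP[_ /vlineP[b ->] [g' Fg' eq_v]].
  suff a0 : a = 0 by rewrite a0 scale0r add0r (subvP (addvSr _ _)).
  have diffF : a *: z (- t) - b *: z t \in F m.+1.
    have -> : a *: z (- t) - b *: z t = g' - g.
      by apply/eqP; rewrite subr_eq addrAC eq_sym subr_eq eq_v addrC.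
    by rewrite rpredB // (subvP sF).
  (* Compare the coefficients of e_i. *)
  have ab : a = b.
    apply/eqP; rewrite -subr_eq0; apply/eqP/(scale_flag lt_iB).
    have -> : (a - b) *: B`_i =
        (a *: z (- t) - b *: z t) + (a * t + b * t) *: B`_m.
      rewrite /z !scalerDr !scalerA mulrN scaleNr scalerBl (scalerDl _ (a * t)) opprD.
      by rewrite (addrACA (a *: B`_i)) -opprD addrNK.
    by apply: rpredD; [apply: (subvP sFi) | apply/memvZ/mem_flag].
  (* Compare the coefficients of e_m; characteristic different from 2 then gives a = 0. *)
  have : (- (2%:R * (a * t))) *: B`_m \in F m.+1.
    move: diffF; rewrite -ab -scalerBr /z opprD addrACA subrr add0r -scalerBl.
    by rewrite scalerA -opprD mulrN mulrDr mulr_natl mulr2n.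
  move/(scale_flag (ltnW lt_mB))/eqP; rewrite oppr_eq0 !mulf_eq0.
  by rewrite (negPf nz_2) (negPf nz_t) orbF => /eqP.
(* e_(m+1) lies in [W], and the product of [z t] and [z (- t)] puts it in the algebra generated by
   [U] and [V]; the modular law carries it into [U]. *)
have memU : B`_m.+1 \in U.
  suff gen : generated mul [predU U & (V :&: W)%VS] B`_m.+1.
    apply: (gen U (alg2 t erefl)) => y /orP[//|]; exact: (subvP sVWU).
  apply: inW; split; last by apply: (subvP (addvSr _ _)); apply: mem_flag.
  move=> T algT sUVT.
  have Tx : z t \in T.
    by apply/sUVT; rewrite inE /= (subvP (addvSl _ _)) ?memv_line.
  have Ty : z (- t) \in T.
    by apply/sUVT; rewrite inE /= orbC (subvP (addvSl _ _)) ?memv_line.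
  have TF y : y \in F m.+2 -> y \in T.
    by move=> Fy; apply/sUVT; rewrite inE /= (subvP (addvSr _ _)).
  have nz_2d : d + t * - t * c != 0.
    rewrite mulrN -expr2 t2E opprK divfK // -mulr2n -mulr_natl.
    exact: mulf_neq0.
  have := algT _ _ Tx Ty; rewrite mul_zE rpredDr; last first.
    by rewrite TF // rpredD ?memvZ.
  by move/(memvZ (d + t * - t * c)^-1); rewrite scalerK.
(* Membership in [U] is absurd: the e_i-coefficient forces a = 0, leaving e_(m+1) in [F m.+2]. *)
have [_ /vlineP[a ->] [g Fg BE]] := memv_addP memU.
have a0 : a = 0.
  apply: (z_out _ t); rewrite -[a *: _](addrK g) -BE rpredB ?mem_flag //.
  exact: (subvP sF).
have : 1 = 0 :> K.
  by apply: (scale_flag lt_mB); rewrite scale1r BE a0 scale0r add0r.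
by move/eqP; rewrite oner_eq0.
Qed.

End Flag.

Theorem corollary5p7 (K : fieldType) (E : vectType K)
    (mul : {bilinear E -> E -> E})
    (quadK : quadratically_closed K)
    (charK : 2%N \notin [pchar K])
    (evolE : evolution_algebra mul)
    (nilE : nilpotent_algebra mul)
    (annE : \dim (annihilator mul) = 1%N) :
  modular_algebra mul <-> distributive_algebra mul.
Proof.
split=> [modE|]; last exact: distributive_modular.
have [B natB triB] := triangular_natural_basis evolE nilE.
by apply: (distributive_flag natB triB) => i; apply: modular_step.
Qed.
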